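(* Let $P$ be a finite poset and let $A$ be the discrete ASL on $P$ over a field $K$. Then the second Veronese algebra $A^{(2)}=\bigoplus_{i\ge0}A_{2i}$ is a homogeneous ASL on the second zig-zag poset $Z_2(P)$ over $K$ (where an element $(\alpha,\beta)$ of $Z_2(P)$ is identified with the product $\alpha\beta\in A_2$).
   Context: All posets are finite. **ASL.** Let $A$ be a $K$-algebra and $P\subset A$ a finite poset. A product $\alpha_1\cdots\alpha_t$ with $\alpha_i\in P$ is a monomial; it is standard if $\alpha_1\le\cdots\le\alpha_t$. $A$ is a (graded) algebra with straightening laws (ASL) on $P$ over $K$ if: (ASL 0) $A=\bigoplus_{i\ge0}A_i$ is a graded $K$-algebra with $A_0=K$, the elements of $P$ are homogeneous of positive degree and generate $A$ as a $K$-algebra; (ASL 1) the standard monomials form a $K$-basis of $A$; (ASL 2) if $\alpha,\beta\in P$ are incomparable and $\alpha\beta=\sum_i r_i\gamma_{i1}\cdots\gamma_{it_i}$, with $0\ne r_i\in K$ and $\gamma_{i1}\le\cdots\le\gamma_{it_i}$, is the unique expression as a linear combination of standard monomials (possibly $0$), then $\gamma_{i1}<\alpha$ and $\gamma_{i1}<\beta$ for every $i$. $A$ is a homogeneous ASL if $P\subset A_1$. **Discrete ASL.** The discrete ASL on $P$ over $K$ is $K[P]/I_P$, where $K[P]$ is the polynomial ring whose variables are the elements of $P$ (each of degree $1$) and $I_P$ is the ideal generated by all products $\alpha\beta$ with $\alpha,\beta\in P$ incomparable. **Veronese algebra.** $A^{(2)}$ is graded by $(A^{(2)})_i=A_{2i}$.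 **Zig-zag poset.** $Z_2(P)=\{(\alpha_1,\alpha_2):\alpha_1,\alpha_2\in P,\ \alpha_1\le\alpha_2\}$, with $(\alpha_1,\alpha_2)\le(\beta_1,\beta_2)$ if and only if $\alpha_1\le\beta_1$ and $\alpha_2\ge\beta_2$. *)

(* Defs.v *)
From HB Require Import structures.
From mathcomp Require Import all_boot all_order all_algebra.
From mathcomp Require Import boolp.
From mathcomp Require Import mpoly.

Set Implicit Arguments.
Unset Strict Implicit.
Unset Printing Implicit Defensive.

Import Order.TTheory GRing.Theory.
Local Open Scope quotient_scope.
Local Open Scope ring_scope.

Section Grading.
Variables (K : fieldType) (A : comAlgType K).

Record is_grading (gr : nat -> A -> Prop) : Prop := IsGrading {
  grading0 : forall i, gr i 0;
  gradingD : forall i x y, gr i x -> gr i y -> gr i (x + y);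
  gradingZ : forall i c x, gr i x -> gr i (c *: x);
  grading1 : gr 0%N 1;
  gradingM : forall i j x y, gr i x -> gr j y -> gr (i + j)%N (x * y);
  grading_span : forall x, exists n (f : nat -> A),
    (forall i, gr i (f i)) /\ x = \sum_(i < n) f i;
  grading_direct : forall n (f : nat -> A), (forall i, gr i (f i)) ->
    \sum_(i < n) f i = 0 -> forall i, (i < n)%N -> f i = 0
}.

Record grading := Grading {
  component :> nat -> A -> Prop;
  componentP : is_grading component
}.

End Grading.

Section ASL.
Variables (K : fieldType) (A : comAlgType K) (gr : nat -> A -> Prop).
Variables (d : Order.disp_t) (P : finPOrderType d) (iota : P -> A).

Definition standard (s : seq P) : bool := sorted <=%O s.

Definition monomial (s : seq P) : A := \prod_(a <- s) iota a.

Definition ASL0 : Prop :=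
  [/\ is_grading gr,
      forall x, gr 0%N x <-> exists c : K, x = c%:A,
      forall a, exists2 i, (0 < i)%N & gr i (iota a)
    & forall B : {pred A}, subalg_closed B -> (forall a, iota a \in B) ->
      forall x, x \in B].

(* A multichain is the same thing as a standard sequence, so the standard
   monomials are a family indexed by standard sequences. *)
Definition ASL1 : Prop :=
  (forall (S : seq (seq P)) (r : seq P -> K), uniq S -> all standard S ->
     \sum_(s <- S) r s *: monomial s = 0 -> {in S, forall s, r s = 0}) /\
  (forall x, exists (S : seq (seq P)) (r : seq P -> K),
     [/\ uniq S, all standard S & x = \sum_(s <- S) r s *: monomial s]).

(* The empty monomial has no first factor, so it may not occur. *)
Definition ASL2 : Prop :=
  forall (a b : P) (S : seq (seq P)) (r : seq P -> K), (a >< b)%O ->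
    uniq S -> all standard S -> {in S, forall s, r s != 0} ->
    iota a * iota b = \sum_(s <- S) r s *: monomial s ->
  {in S, forall s, if s is c :: _ then (c < a)%O && (c < b)%O else false}.

Definition is_ASL : Prop := [/\ injective iota, ASL0, ASL1 & ASL2].

Definition is_homogeneous_ASL : Prop := is_ASL /\ forall a, gr 1%N (iota a).

End ASL.

Section Veronese.
Variables (K : fieldType) (A : comAlgType K) (G : grading A).

Definition in_veronese2 : {pred A} := fun x =>
  `[< exists n (f : nat -> A),
        (forall i, G (2 * i)%N (f i)) /\ x = \sum_(i < n) f i >].

Lemma component_veronese2 i x : G (2 * i)%N x -> x \in in_veronese2.
Proof.
have [G0 _ _ _ _ _ _] := componentP G; move=> Gx; apply/asboolP.
exists i.+1, (fun j => if j == i then x else 0); split.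
  by move=> j; case: eqP => [->|_].
rewrite (bigD1 ord_max) //= eqxx big1 ?addr0 // => j.
by rewrite -val_eqE /= => /negPf->.
Qed.

Lemma in_veronese2D : {in in_veronese2 &, forall x y, x + y \in in_veronese2}.
Proof.
have [G0 GD _ _ _ _ _] := componentP G.
have widen n (f : nat -> A) m : (n <= m)%N ->
    \sum_(i < n) f i = \sum_(i < m) (if (i < n)%N then f i else 0) :> A.
  by move=> lenm; rewrite (big_ord_widen m) // big_mkcond.
move=> x y /asboolP[n [f [Gf ->]]] /asboolP[m [g [Gg ->]]]; apply/asboolP.
exists (maxn n m), (fun i => (if (i < n)%N then f i else 0) +
                             (if (i < m)%N then g i else 0)); split.
  by move=> i; apply: GD; case: ifP.
by rewrite big_split -!widen ?leq_maxl ?leq_maxr.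
Qed.

Lemma in_veronese2_sum n (f : 'I_n -> A) :
  (forall i, f i \in in_veronese2) -> \sum_i f i \in in_veronese2.
Proof.
move=> Vf; elim/big_ind: _ => //; last exact: in_veronese2D.
exact: (@component_veronese2 0) (grading0 (componentP G) _).
Qed.

Lemma veronese2_subalg_closed : subalg_closed in_veronese2.
Proof.
have [_ _ GZ G1 GM _ _] := componentP G; split.
- exact: (@component_veronese2 0).
- move=> c x y /asboolP[n [f [Gf ->]]] Vy; apply: in_veronese2D => //.
  rewrite scaler_sumr; apply: in_veronese2_sum => i.
  exact: component_veronese2 (GZ _ _ _ (Gf i)).
- move=> _ _ /asboolP[n [f [Gf ->]]] /asboolP[m [g [Gg ->]]].
  rewrite mulr_suml; apply: in_veronese2_sum => i.
  rewrite mulr_sumr; apply: in_veronese2_sum => j.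
  by apply: (@component_veronese2 (i + j)); rewrite mulnDr; apply: GM.
Qed.

HB.instance Definition _ :=
  GRing.isSubalgClosed.Build K A in_veronese2 veronese2_subalg_closed.

Record veronese2 := Veronese2 {
  veronese2_val : A;
  veronese2_valP : veronese2_val \in in_veronese2
}.

HB.instance Definition _ := [isSub of veronese2 for veronese2_val].
HB.instance Definition _ := [Choice of veronese2 by <:].
HB.instance Definition _ := [SubChoice_isSubComNzRing of veronese2 by <:].
HB.instance Definition _ := [SubZmodule_isSubLmodule of veronese2 by <:].
HB.instance Definition _ :=
  [SubNzRing_SubLmodule_isSubLalgebra of veronese2 by <:].
HB.instance Definition _ := [SubLalgebra_isSubAlgebra of veronese2 by <:].

Definition veronese2_component (i : nat) (x : veronese2) : Prop :=
  G (2 * i)%N (val x).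

End Veronese.

Section ZigZag.
Variables (d : Order.disp_t) (P : finPOrderType d).

Record zigzag2 := Zigzag2 {
  zigzag2_val : P * P;
  zigzag2P : (zigzag2_val.1 <= zigzag2_val.2)%O
}.

HB.instance Definition _ := [isSub for zigzag2_val].
HB.instance Definition _ := [Finite of zigzag2 by <:].

Definition zigzag2_le (x y : zigzag2) : bool :=
  ((val x).1 <= (val y).1)%O && ((val y).2 <= (val x).2)%O.

Fact zigzag2_le_refl : reflexive zigzag2_le.
Proof. by move=> x; rewrite /zigzag2_le !lexx. Qed.

Fact zigzag2_le_anti : antisymmetric zigzag2_le.
Proof.
move=> x y /andP[/andP[x1 y2] /andP[y1 x2]]; apply: val_inj.
rewrite [val x]surjective_pairing [val y]surjective_pairing.
by congr (_, _); apply: le_anti; rewrite ?x1 ?x2 ?y1 ?y2.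
Qed.

Fact zigzag2_le_trans : transitive zigzag2_le.
Proof.
move=> y x z /andP[xy1 yx2] /andP[yz1 zy2]; rewrite /zigzag2_le.
by rewrite (le_trans xy1 yz1) (le_trans zy2 yx2).
Qed.

HB.instance Definition _ := Order.Le_isPOrder.Build d zigzag2
  zigzag2_le_refl zigzag2_le_anti zigzag2_le_trans.

End ZigZag.

Section DiscreteASL.
Variables (K : fieldType) (d : Order.disp_t) (P : finPOrderType d).

(* K[P]; the variable attached to a : P is ['X_(enum_rank a)] *)
Local Notation KP := {mpoly K[#|P|]}.

Definition polyvar (a : P) : KP := 'X_(enum_rank a).

Definition discrete_ideal : {pred KP} := fun p =>
  `[< exists q : P -> P -> KP,
        p = \sum_a \sum_(b | (a >< b)%O) q a b * (polyvar a * polyvar b) >].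

Lemma discrete_ideal_closed : idealr_closed discrete_ideal.
Proof.
split.
- apply/asboolP; exists (fun _ _ => 0).
  by rewrite big1 // => a _; rewrite big1 // => b _; rewrite mul0r.
- apply/asboolP=> -[q /(congr1 (mcoeff 0%MM))]; rewrite mcoeff1 eqxx.
  rewrite raddf_sum big1 => [/eqP|a _]; first by rewrite oner_eq0.
  rewrite raddf_sum big1 // => b _.
  by rewrite /= mulrA (rmorphM (mcoeff 0%MM)) /= mcoeffX mnm1_eq0 mulr0.
- move=> c x y /asboolP[q ->] /asboolP[q' ->]; apply/asboolP.
  exists (fun a b => c * q a b + q' a b).
  rewrite mulr_sumr -big_split; apply: eq_bigr => a _ /=.
  rewrite mulr_sumr -big_split; apply: eq_bigr => b _ /=.
  by rewrite mulrDl !mulrA.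
Qed.

HB.instance Definition _ := isIdealr.Build KP discrete_ideal discrete_ideal_closed.

Definition discrete_ASL : Type := {ideal_quot discrete_ideal}.

HB.instance Definition _ := GRing.ComNzRing.on discrete_ASL.

Definition discrete_pi (p : KP) : discrete_ASL :=
  \pi_({ideal_quot discrete_ideal}) p.

Lemma discrete_pi_is_zmod_morphism : zmod_morphism discrete_pi.
Proof. by move=> p q; rewrite /discrete_pi rmorphB. Qed.

Lemma discrete_pi_is_monoid_morphism : monoid_morphism discrete_pi.
Proof.
by split=> [|p q]; rewrite /discrete_pi ?rmorph1 ?rmorphM.
Qed.

HB.instance Definition _ := GRing.isZmodMorphism.Build KP discrete_ASL
  discrete_pi discrete_pi_is_zmod_morphism.
HB.instance Definition _ := GRing.isMonoidMorphism.Build KP discrete_ASL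
  discrete_pi discrete_pi_is_monoid_morphism.

Lemma discrete_pi_surj (x : discrete_ASL) : exists p, x = discrete_pi p.
Proof. by exists (repr x); rewrite /discrete_pi reprK. Qed.

Lemma discrete_pi_eq0 p : (discrete_pi p == 0) = (p \in discrete_ideal).
Proof.
by rewrite -[p in RHS]subr0 Quotient.idealrBE -(rmorph0 discrete_pi).
Qed.

Definition discrete_scale (c : K) (x : discrete_ASL) : discrete_ASL :=
  discrete_pi c%:MP * x.

Fact discrete_scaleA c e x :
  discrete_scale c (discrete_scale e x) = discrete_scale (c * e) x.
Proof. by rewrite /discrete_scale mulrA -rmorphM /= -mpolyCM. Qed.

Fact discrete_scale1 : left_id 1 discrete_scale.
Proof. by move=> x; rewrite /discrete_scale rmorph1 mul1r. Qed.

Fact discrete_scaleDr : right_distributive discrete_scale +%R.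
Proof. by move=> c x y; rewrite /discrete_scale mulrDr. Qed.

Fact discrete_scaleDl x : {morph discrete_scale^~ x : c e / c + e}.
Proof. by move=> c e; rewrite /discrete_scale mpolyCD rmorphD mulrDl. Qed.

HB.instance Definition _ := GRing.Zmodule_isLmodule.Build K discrete_ASL
  discrete_scaleA discrete_scale1 discrete_scaleDr discrete_scaleDl.

Fact discrete_scaleAl (c : K) (x y : discrete_ASL) : c *: (x * y) = c *: x * y.
Proof. exact: mulrA. Qed.

HB.instance Definition _ :=
  GRing.Lmodule_isLalgebra.Build K discrete_ASL discrete_scaleAl.
HB.instance Definition _ := GRing.Lalgebra_isComAlgebra.Build K discrete_ASL.

Lemma discrete_piZ c p : discrete_pi (c *: p) = c *: discrete_pi p.
Proof. by rewrite -mul_mpolyC rmorphM. Qed.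

Definition discrete_component (i : nat) (x : discrete_ASL) : Prop :=
  exists2 p : KP, p \is i.-homog & x = discrete_pi p.

Lemma discrete_ideal_pihomog i p :
  p \in discrete_ideal -> pihomog mdeg i p \in discrete_ideal.
Proof.
move=> /asboolP[q ->]; rewrite raddf_sum; apply: rpred_sum => a _.
rewrite raddf_sum; apply: rpred_sum => b ab /=.
rewrite (pihomog_partitionE (leqnn (mmeasure mdeg (q a b)))).
rewrite mulr_suml raddf_sum; apply: rpred_sum => j _ /=.
set r := pihomog mdeg j _; have rab : r * (polyvar a * polyvar b) \in discrete_ideal.
  rewrite idealMr //; apply/asboolP.
  exists (fun a' b' => ((a' == a) && (b' == b))%:R).
  rewrite (bigD1 a) //= [X in _ + X]big1 ?addr0 => [|a' /negPf a'a].
    rewrite (bigD1 b) //= [X in _ + X]big1 ?addr0 => [|b' /andP[_ /negPf b'b]].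
      by rewrite !eqxx mul1r.
    by rewrite b'b andbF mul0r.
  by rewrite big1 // => b' _; rewrite a'a mul0r.
have hom : r * (polyvar a * polyvar b) \is (j + (1 + 1)).-homog.
  apply: dhomogM; first exact: pihomogP.
  by apply: dhomogM; rewrite dhomogX; apply/eqP; exact: mdeg1.
have [<-|ne] := eqVneq (j + (1 + 1))%N i; first by rewrite pihomog_dE.
by rewrite (pihomog_ne0 _ hom) ?rpred0 // eq_sym.
Qed.

Lemma discrete_is_grading : is_grading discrete_component.
Proof.
split.
- by move=> i; exists 0; rewrite ?rpred0 ?rmorph0.
- move=> i _ _ [p hp ->] [q hq ->].
  by exists (p + q); rewrite ?rpredD ?rmorphD.
- by move=> i c _ [p hp ->]; exists (c *: p); rewrite ?rpredZ ?discrete_piZ.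
- by exists 1; rewrite ?dhomog1 ?rmorph1.
- move=> i j _ _ [p hp ->] [q hq ->].
  by exists (p * q); rewrite ?rmorphM ?dhomogM.
- move=> x; have [p ->] := discrete_pi_surj x.
  exists (mmeasure mdeg p), (fun i => discrete_pi (pihomog mdeg i p)); split.
    by move=> i; exists (pihomog mdeg i p); rewrite ?pihomogP.
  by rewrite {1}(pihomog_partitionE (leqnn (mmeasure mdeg p))) rmorph_sum.
- move=> n f hf; have /boolp.choice[p hp] : forall i, exists p : KP,
      p \is i.-homog /\ f i = discrete_pi p.
    by move=> i; have [p homp fi] := hf i; exists p.
  under eq_bigr => i _ do rewrite (hp i).2.
  rewrite -rmorph_sum => /eqP; rewrite discrete_pi_eq0 => sumI i lt_in.
  have := discrete_ideal_pihomog i sumI; rewrite (hp i).2 raddf_sum.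
  rewrite (bigD1 (Ordinal lt_in)) //= big1 => [|j].
    by rewrite addr0 pihomog_dE ?(hp i).1 // -discrete_pi_eq0 => /eqP.
  by rewrite -val_eqE /= => ne; rewrite (pihomog_ne0 ne) ?(hp j).1.
Qed.

Definition discrete_grading : grading discrete_ASL :=
  Grading discrete_is_grading.

Definition discrete_gen (a : P) : discrete_ASL := discrete_pi (polyvar a).

Lemma discrete_gen_component a : discrete_component 1 (discrete_gen a).
Proof. by exists (polyvar a); rewrite // dhomogX; apply/eqP; exact: mdeg1. Qed.

Fact zigzag2_embed_subproof (z : zigzag2 P) :
  discrete_gen (val z).1 * discrete_gen (val z).2
    \in in_veronese2 discrete_grading.
Proof.
apply: (@component_veronese2 _ _ _ 1).
exact: (gradingM (componentP discrete_grading) (discrete_gen_component _)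
          (discrete_gen_component _)).
Qed.

Definition zigzag2_embed (z : zigzag2 P) : veronese2 discrete_grading :=
  Veronese2 (zigzag2_embed_subproof z).

End DiscreteASL.

(* Main.v *)
Require Import Defs.
From HB Require Import structures.
From mathcomp Require Import all_boot all_order all_algebra.
From mathcomp Require Import boolp mpoly.

(** Write A = K[P]/I_P.  The ideal I_P is spanned by monomials: a polynomial
    lies in it exactly when its coefficients vanish at all monomials supported
    on a chain of P ([discrete_ideal_coef], [discrete_pi_nonchain]).  So the
    coefficient at a chain monomial is well defined on A
    ([discrete_pi_coef]), and the chain monomials, read as weakly increasing
    words in P, form a basis of A.

    A multichain (a_1,b_1) <= ... <= (a_t,b_t) of Z_2(P) is a family of nested
    intervals, that is, a weakly increasing word a_1 ... a_t b_t ... b_1 of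
    length 2t.  Peeling off the two ends of a word inverts this, so [nest] is a
    bijection from the multichains of Z_2(P) onto the weakly increasing words
    of even length in P ([standard_nest], [nest_inj], [sorted_nest]).  The
    standard monomial of a multichain is the chain monomial of its word, and
    the words of even length are those that survive in the Veronese algebra;
    hence the standard monomials on Z_2(P) form a basis of it.

    For the straightening law, let y, z be incomparable in Z_2(P), and let a
    standard monomial c_1 ... c_t occur in the expansion of yz.  Reading off the
    coefficient at its word shows that this word is a rearrangement of the
    four letters of y and z ([combination_coef]).  The components of c_1 are
    the least and the greatest letter of the word, so c_1 <= y and c_1 <= z,
    and both inequalities are strict because y and z are incomparable. *)

Set Implicit Arguments.
Unset Strict Implicit.
Unset Printing Implicit Defensive.

Import Order.TTheory GRing.Theory.
Local Open Scope ring_scope.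

(** * The grading of the second Veronese algebra *)

Section VeroneseGrading.
Variables (K : fieldType) (A : comAlgType K) (G : grading A).

Lemma veronese2_is_grading : is_grading (veronese2_component (G := G)).
Proof.
have [G0 GD GZ G1 GM _ Gdirect] := componentP G.
split; rewrite /veronese2_component.
- by move=> i; apply: G0.
- by move=> i x y; apply: GD.
- by move=> i c x; apply: GZ.
- exact: G1.
- by move=> i j x y Gx Gy; rewrite mulnDr; apply: GM.
- move=> x; have /asboolP[n [f [Gf xE]]] := veronese2_valP x.
  exists n, (fun i => Veronese2 (component_veronese2 (Gf i))); split=> //.
  by apply: val_inj; rewrite raddf_sum -xE.
- move=> n f Gf sum0 i lt_in.
  (* Directness in A is about consecutive degrees, so the family is spread
     over the even ones and padded with zeros. *)
  pose g j := if odd j then 0 else val (f j./2).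
  have Gg j : G j (g j).
    rewrite /g; case: ifP => [_|even_j]; first exact: G0.
    by rewrite -{1}(odd_double_half j) even_j add0n -mul2n; apply: Gf.
  have sum_g m : \sum_(j < m.*2) g j = val (\sum_(j < m) f j).
    elim: m => [|m IHm]; first by rewrite !big_ord0.
    rewrite doubleS 2!big_ord_recr /= IHm big_ord_recr /=.
    by rewrite /g /= odd_double /= doubleK addr0.
  have := Gdirect n.*2 g Gg; rewrite sum_g sum0 => /(_ erefl i.*2).
  rewrite ltn_double /g odd_double doubleK => /(_ lt_in) fi0.
  exact: val_inj.
Qed.

End VeroneseGrading.

(** * Chain monomials of the discrete algebra *)

Section ChainMonomials.
Variables (K : fieldType) (d : Order.disp_t) (P : finPOrderType d).
Local Notation KP := {mpoly K[#|P|]}.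
Implicit Types (m : 'X_{1..#|P|}) (p q : KP) (t : seq P).

Definition chain_support m : bool :=
  [forall a : P, forall b : P,
    (m (enum_rank a) != 0%N) ==> (m (enum_rank b) != 0%N) ==> (a >=< b)%O].

(** Every monomial occurring in a multiple of [polyvar a * polyvar b] has both
    a and b in its support; when a and b are incomparable this support is not
    a chain. *)
Lemma discrete_ideal_coef p m :
  p \in discrete_ideal (P := P) -> chain_support m -> p@_m = 0.
Proof.
move=> /asboolP[q ->] chain_m.
rewrite raddf_sum big1 // => a _; rewrite raddf_sum big1 // => b /= ab.
rewrite /polyvar -mpolyXD (mpolyE (q a b)) mulr_suml raddf_sum big1 // => k _.
rewrite /= -scalerAl -mpolyXD mcoeffZ mcoeffX; case: eqP => [km|]; last first.
  by rewrite mulr0.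
have /forallP/(_ a)/forallP/(_ b) := chain_m.
rewrite -km !mnmDE !mnm1E !eqxx !addn_eq0 !andbF /=.
by rewrite (negPf ab).
Qed.

(** The coefficients at chain monomials descend to the quotient; every
    independence and uniqueness claim below is an instance of this. *)
Lemma discrete_pi_coef p q m :
  discrete_pi p = discrete_pi q -> chain_support m -> p@_m = q@_m.
Proof.
move=> pq chain_m; apply/eqP; rewrite -subr_eq0 -mcoeffB.
by rewrite discrete_ideal_coef // -discrete_pi_eq0 rmorphB /= pq subrr.
Qed.

Lemma discrete_pi_nonchain m :
  ~~ chain_support m -> discrete_pi ('X_[m] : KP) = 0.
Proof.
rewrite negb_forall => /existsP[a]; rewrite negb_forall => /existsP[b].
rewrite !negb_imply => /and3P[ma mb ab].
have neq : enum_rank a != enum_rank b.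
  by apply: contraNneq ab => /enum_rank_inj->; rewrite comparablexx.
have le_abm : ((U_(enum_rank a) + U_(enum_rank b))%MM <= m)%MM.
  apply/mnm_lepP => i; rewrite mnmDE !mnm1E.
  case: eqP => [<-|_]; first by rewrite eq_sym (negPf neq) addn0 lt0n.
  by case: eqP => [<-|_] //; rewrite lt0n.
apply/eqP; rewrite -(submK le_abm) mpolyXD discrete_pi_eq0.
rewrite idealMr // mpolyXD; apply/asboolP.
(* The multiplier 1 at (a, b) and 0 elsewhere shows that the generator
   [polyvar a * polyvar b] is itself in the ideal. *)
exists (fun a' b' => ((a' == a) && (b' == b))%:R).
rewrite (bigD1 a) //= [X in _ + X]big1 ?addr0 => [|a' /negPf a'a].
  rewrite (bigD1 b) //= [X in _ + X]big1 ?addr0 => [|b' /andP[_ /negPf b'b]].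
    by rewrite !eqxx mul1r.
  by rewrite b'b andbF mul0r.
by rewrite big1 // => b' _; rewrite a'a mul0r.
Qed.

Definition exponent t : 'X_{1..#|P|} := (\sum_(a <- t) U_(enum_rank a))%MM.

Lemma exponentE t a : exponent t (enum_rank a) = count_mem a t.
Proof.
rewrite mnm_sumE -sum1_count [RHS]big_mkcond /=; apply: eq_bigr => b _.
by rewrite mnm1E (inj_eq enum_rank_inj); case: eqP.
Qed.

Lemma mdeg_exponent t : mdeg (exponent t) = size t.
Proof.
by rewrite mdeg_sum -sum1_size; apply: eq_bigr => a _; rewrite mdeg1.
Qed.

(** Monomials are words up to order; a sorted word is therefore determined by
    its monomial. *)
Lemma exponent_perm s t : (exponent s == exponent t) = perm_eq s t.
Proof.
apply/eqP/idP => [st|st]; last exact: perm_big.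
by apply/allP => a _ /=; rewrite -!exponentE st.
Qed.

Lemma exponent_surj m : exists t, exponent t = m.
Proof.
have [n] := ubnP (mdeg m); elim: n m => // n IHn m.
have [/eqP|] := eqVneq (mdeg m) 0%N.
  by rewrite mdeg_eq0 => /eqP-> _; exists [::]; rewrite /exponent big_nil.
rewrite mdeg_eq0 => m_neq0; have [i mi] : exists i, m i != 0%N.
  apply/existsP; apply: contraR m_neq0; rewrite negb_exists => /forallP m0.
  by apply/eqP/mnmP => i; rewrite mnm0E; apply/eqP; rewrite -[_ == _]negbK.
have Um : (U_(i) <= m)%MM by rewrite lep1mP.
rewrite -{1}(submK Um) mdegD mdeg1 addn1 ltnS => /IHn[t tE].
exists (enum_val i :: t); rewrite /exponent big_cons enum_valK -/(exponent t).
by rewrite tE addmC submK.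
Qed.

Lemma chain_support_exponent t :
  chain_support (exponent t) = all2rel >=<%O t.
Proof.
apply/forallP/allrelP => [chain_t a b|chain_t a].
  rewrite -!has_pred1 !has_count -!exponentE !lt0n => ta tb.
  by have /forallP/(_ b) := chain_t a; rewrite ta tb.
apply/forallP => b; apply/implyP => ta; apply/implyP => tb.
by apply: chain_t; rewrite -has_pred1 has_count -exponentE lt0n.
Qed.

Lemma sorted_chain_support t : sorted <=%O t -> chain_support (exponent t).
Proof.
rewrite chain_support_exponent; elim: t => // a t IHt.
rewrite /= path_sortedE; last exact: le_trans.
case/andP => /allP at_ /IHt /allrelP chain_t; apply/allrelP => x y.
rewrite !inE => /predU1P[->|xt] /predU1P[->|yt].
- exact: comparablexx.
- by apply: le_comparable; apply: at_.
- by apply: ge_comparable; apply: at_.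
- exact: chain_t.
Qed.

(** The order of P is partial, but it is total on the letters of a word with
    chain support, so sorting such a word does produce a sorted one. *)
Lemma chain_sorted_word m :
  chain_support m -> exists2 t, sorted <=%O t & exponent t = m.
Proof.
have [t <-] := exponent_surj m; rewrite chain_support_exponent => /allrelP chain_t.
exists (sort <=%O t); last by apply/eqP; rewrite exponent_perm perm_sort.
apply: (sort_sorted_in (P := mem t)); last exact/allP.
by move=> a b; exact: chain_t.
Qed.

Lemma discrete_pi_word t :
  \prod_(a <- t) discrete_gen K a = discrete_pi 'X_[exponent t].
Proof. by rewrite /exponent -mprodXE rmorph_prod. Qed.

End ChainMonomials.

(** * Multichains of intervals as words of even length *)

Section Nesting.
Variables (d : Order.disp_t) (P : finPOrderType d).
Implicit Types (z : zigzag2 P) (s : seq (zigzag2 P)) (t : seq P).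

(** For s = (a_1,b_1), ..., (a_t,b_t) this is a_1 ... a_t b_t ... b_1.  Wrapping
    the ends of the outermost interval around the rest makes both injectivity
    and surjectivity onto even words plain inductions. *)
Definition nest s : seq P :=
  foldr (fun z t => (val z).1 :: rcons t (val z).2) [::] s.

Lemma all_nest (Q : pred P) s :
  all Q (nest s) = all (fun z => Q (val z).1 && Q (val z).2) s.
Proof. by elim: s => //= z s IHs; rewrite all_rcons IHs andbA. Qed.

(** Since y.1 <= y.2, the interval z contains the interval y as soon as it
    contains both ends of y; this turns comparisons in Z_2(P) into comparisons
    of letters, which do not depend on how the letters are paired up. *)
Lemma all_zigzag2_le z s :
  all (fun y => z <= y)%O s =
  all (fun a => ((val z).1 <= a)%O && (a <= (val z).2)%O) (nest s).
Proof.
rewrite all_nest; apply: eq_all => y.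
apply/andP/andP => [[zy1 yz2]|[/andP[zy1 _] /andP[_ yz2]]] //.
have y12 := zigzag2P y.
by rewrite zy1 yz2 (le_trans y12 yz2) (le_trans zy1 y12).
Qed.

Lemma standard_nest s : standard s = sorted <=%O (nest s).
Proof.
rewrite /standard !sorted_pairwise; do ?exact: le_trans.
elim: s => // z s IHs; rewrite pairwise_cons /= pairwise_rcons all_rcons -IHs.
by rewrite all_zigzag2_le all_predI (zigzag2P z) /= andbA.
Qed.

Lemma nest_inj : injective nest.
Proof.
elim=> [|y s IHs] [|z t] //= [yz1 /rcons_inj[/IHs-> yz2]].
congr (_ :: _); apply: val_inj.
by rewrite [val y]surjective_pairing yz1 yz2 -surjective_pairing.
Qed.

Lemma sorted_nest t :
  sorted <=%O t -> ~~ odd (size t) -> exists s, nest s = t.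
Proof.
have [n] := ubnP (size t); elim: n t => // n IHn [|a t]; first by exists [::].
case/lastP: t => [|t b] //=; rewrite size_rcons ltnS /= negbK.
rewrite path_sortedE; last exact: le_trans.
rewrite all_rcons => size_t /andP[/andP[ab _] sorted_tb] even_t.
have [||s sE] := IHn t _ _ even_t; first exact: ltnW.
  by move: sorted_tb; rewrite -cats1 => /cat_sorted2[].
by exists (@Zigzag2 _ _ (a, b) ab :: s); rewrite /= sE.
Qed.

End Nesting.

(** * The straightening laws *)

Section ZigZagASL.
Variables (K : fieldType) (d : Order.disp_t) (P : finPOrderType d).
Local Notation KP := {mpoly K[#|P|]}.
Local Notation A2 := (veronese2 (discrete_grading K P)).
Local Notation embed := (@zigzag2_embed K d P).
Implicit Types (s : seq (zigzag2 P)) (S : seq (seq (zigzag2 P))).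

Lemma val_monomial s :
  val (monomial embed s) = discrete_pi ('X_[exponent (nest s)] : KP).
Proof.
rewrite -discrete_pi_word /monomial rmorph_prod /=.
elim: s => [|z s IHs]; first by rewrite !big_nil.
rewrite !big_cons big_rcons /= -IHs -mulrA; congr (_ * _).
by rewrite mulrC.
Qed.

Lemma val_combination S (r : seq (zigzag2 P) -> K) :
  val (\sum_(s <- S) r s *: monomial embed s) =
  discrete_pi (\sum_(s <- S) r s *: 'X_[exponent (nest s)] : KP).
Proof.
rewrite !raddf_sum; apply: eq_bigr => s _.
by rewrite /= discrete_piZ -val_monomial.
Qed.

Lemma exponent_nest_inj s t :
  standard s -> standard t -> exponent (nest s) = exponent (nest t) -> s = t.
Proof.
rewrite !standard_nest => sorted_s sorted_t /eqP; rewrite exponent_perm => st.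
by apply/nest_inj/(sorted_eq le_trans le_anti).
Qed.

(** The coefficients of a combination of standard monomials can be read off
    any polynomial representing it, in standard form or not.  With p = 0 this
    is linear independence, with p a single monomial it is injectivity of the
    embedding and control over the straightening relations. *)
Lemma combination_coef S (r : seq (zigzag2 P) -> K) (p : KP) s0 :
    uniq S -> all (@standard _ _) S -> s0 \in S ->
    val (\sum_(s <- S) r s *: monomial embed s) = discrete_pi p ->
  r s0 = p@_(exponent (nest s0)).
Proof.
move=> uniqS /allP stdS Ss0; rewrite val_combination => /discrete_pi_coef.
move/(_ (exponent (nest s0))) => <-; last first.
  by apply: sorted_chain_support; rewrite -standard_nest stdS.
rewrite raddf_sum (bigD1_seq s0) //= big_seq_cond big1 => [|s]; last first.
  case/andP=> Ss ne; rewrite mcoeffZ mcoeffX; case: eqP => [|_].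
    by move/exponent_nest_inj => eq_s; rewrite eq_s ?eqxx ?stdS // in ne.
  by rewrite mulr0.
by rewrite mcoeffZ mcoeffX eqxx mulr1 addr0.
Qed.

Lemma veronese2_lift (x : A2) :
  exists2 p : KP, val x = discrete_pi p & forall m, odd (mdeg m) -> p@_m = 0.
Proof.
have /asboolP[n [f [Gf xE]]] := veronese2_valP x.
have /boolp.choice[p hp] : forall i, exists p : KP,
    p \is (2 * i)%N.-homog /\ f i = discrete_pi p.
  by move=> i; have [p] := Gf i; exists p.
exists (\sum_(i < n) p i) => [|m odd_m].
  by rewrite rmorph_sum [LHS]xE; apply: eq_bigr => i _; case: (hp i).
rewrite raddf_sum big1 // => i _; apply: dhomog_nemf_coeff (hp i).1 _.
by apply: contraTneq odd_m => /= ->; rewrite mul2n odd_double.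
Qed.

(** For spanning, lift to a polynomial with monomials of even degree only: those
    without chain support vanish in the quotient, and the others are words of
    even length, hence of the form [nest s]. *)
Lemma zigzag2_ASL1 : ASL1 embed.
Proof.
split=> [S r uniqS stdS sum0 s Ss|x].
  have := combination_coef (r := r) (p := 0) uniqS stdS Ss.
  by rewrite sum0 mcoeff0 !rmorph0 => ->.
have [p xE p_even] := veronese2_lift x.
have /boolp.choice[w wP] : forall m : 'X_{1..#|P|}, exists s,
    chain_support m -> ~~ odd (mdeg m) -> standard s /\ exponent (nest s) = m.
  move=> m; have [chain_m|] := boolP (chain_support m); last by exists [::].
  have [odd_m|even_m] := boolP (odd (mdeg m)); first by exists [::].
  have [t sorted_t tE] := chain_sorted_word chain_m.
  rewrite -tE mdeg_exponent in even_m.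
  have [s sE] := sorted_nest sorted_t even_m.
  by exists s => _ _; rewrite standard_nest sE.
pose M := [seq m <- msupp p | chain_support m].
have MP m : m \in M -> standard (w m) /\ exponent (nest (w m)) = m.
  rewrite mem_filter mcoeff_msupp => /andP[chain_m pm]; apply: wP => //.
  by apply: contraNN pm => /p_even->.
exists [seq w m | m <- M], (fun s => p@_(exponent (nest s))); split.
- rewrite map_inj_in_uniq ?filter_uniq ?msupp_uniq // => m1 m2 Mm1 Mm2 eq_w.
  by rewrite -(MP _ Mm1).2 eq_w (MP _ Mm2).2.
- by apply/allP => _ /mapP[m Mm ->]; case: (MP m Mm).
- apply: val_inj; rewrite [LHS]xE val_combination big_map big_filter.
  rewrite {1}(mpolyE p) !rmorph_sum /= (bigID (@chain_support _ P)) /=.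
  rewrite [X in _ + X]big1 ?addr0 => [|m nonchain_m]; last first.
    by rewrite discrete_piZ discrete_pi_nonchain // scaler0.
  rewrite big_seq_cond [RHS]big_seq_cond; apply: eq_bigr => m /andP[pm chain_m].
  by rewrite (MP m _).2 // mem_filter chain_m.
Qed.

(** Comparing the one-letter monomials [:: y] and [:: z] suffices, because the
    standard ones are determined by their exponents. *)
Lemma zigzag2_embed_inj : injective embed.
Proof.
move=> y z eq_yz.
have eq_mon : val (\sum_(s <- [:: [:: y]]) (1 : K) *: monomial embed s) =
    discrete_pi ('X_[exponent (nest [:: z])] : KP).
  by rewrite -val_monomial big_seq1 scale1r /monomial !big_seq1 eq_yz.
have := combination_coef (S := [:: [:: y]]) (r := fun=> 1) isT isT
  (mem_head _ _) eq_mon.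
rewrite mcoeffX; case: eqP => [/exponent_nest_inj|_ /eqP]; last first.
  by rewrite oner_eq0.
by move=> /(_ isT isT)[->] _.
Qed.

Lemma zigzag2_embed_component (z : zigzag2 P) :
  veronese2_component 1 (embed z).
Proof.
exact: (gradingM (componentP (discrete_grading K P))
  (discrete_gen_component _ _) (discrete_gen_component _ _)).
Qed.

Lemma zigzag2_ASL0 :
  ASL0 (veronese2_component (G := discrete_grading K P)) embed.
Proof.
split; first exact: veronese2_is_grading.
- move=> x; split=> [[p hom_p xE]|[c ->]].
    exists p@_0%MM; apply: val_inj; rewrite [LHS]xE.
    have pE : p = p@_0%MM *: 1.
      apply/mpolyP => m; rewrite mcoeffZ mcoeff1.
      have [->|m0] := eqVneq m 0%MM; first by rewrite mulr1.
      by rewrite mulr0 (dhomog_nemf_coeff hom_p) //= mdeg_eq0.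
    by rewrite {1}pE discrete_piZ rmorph1.
  exact: gradingZ (veronese2_is_grading _) _ _ _
    (grading1 (veronese2_is_grading _)).
- move=> z; exists 1%N => //; exact: zigzag2_embed_component.
- move=> B [B1 Blin BM] Bemb x.
  have [S [r [_ _ ->]]] := zigzag2_ASL1.2 x.
  have B0 : 0 \in B by have := Blin (-1) 1 1 B1 B1; rewrite scaleN1r addNr.
  have BZ c y : y \in B -> c *: y \in B.
    by move=> By; rewrite -[c *: y]addr0 Blin.
  elim: S => [|s S IHS]; rewrite ?big_nil ?big_cons // Blin //.
  by rewrite /monomial; elim/big_ind: _.
Qed.

(** Only the multiset of letters of a product matters: it is that of y and z
    for every standard monomial that occurs, and the first factor c of such a
    monomial encloses all its letters. *)
Lemma zigzag2_ASL2 : ASL2 embed.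
Proof.
move=> y z S r yz uniqS stdS r0 eq_yz s Ss.
have eq_mon : val (\sum_(s <- S) r s *: monomial embed s) =
    discrete_pi ('X_[exponent (nest [:: y; z])] : KP).
  by rewrite -eq_yz -val_monomial /monomial big_cons big_seq1.
have := r0 s Ss; rewrite (combination_coef uniqS stdS Ss eq_mon) mcoeffX.
case: (exponent _ =P _) => [/eqP|]; last by rewrite eqxx.
rewrite exponent_perm => perm_s _.
have := allP stdS s Ss; case: s {Ss} perm_s => [|c s] perm_s.
  by have := perm_size perm_s.
rewrite /standard /= path_sortedE; last exact: le_trans.
case/andP=> c_min _.
(* [:: y; z] need not be standard; being enclosed by c depends only on the
   letters. *)
have : all (fun x => c <= x)%O [:: y; z].
  by rewrite all_zigzag2_le (perm_all _ perm_s) -all_zigzag2_le /= lexx.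
rewrite /= andbT => /andP[cy cz]; rewrite !lt_neqAle cy cz !andbT.
by apply/andP; split; apply: contraNneq yz => <-;
  rewrite /Order.comparable ?cy ?cz ?orbT.
Qed.

End ZigZagASL.

Theorem theorem3p1 (K : fieldType) (d : Order.disp_t) (P : finPOrderType d) :
  is_homogeneous_ASL
    (veronese2_component (G := discrete_grading K P))
    (@zigzag2_embed K d P).
Proof.
split; last exact: zigzag2_embed_component.
split; first exact: zigzag2_embed_inj.
- exact: zigzag2_ASL0.
- exact: zigzag2_ASL1.
- exact: zigzag2_ASL2.
Qed.
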